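(* Let $X=\Gamma\backslash\mathcal{H}$ be a finite-area, non-compact hyperbolic surface whose Laplacian has infinitely many discrete eigenvalues $\lambda\ge 1/4$, and let $\mathcal{N}(t)$, $\mathcal{M}(t)$, $S(t)=\mathcal{N}(t)-\mathcal{M}(t)$ be as in the context. Let a finite list of (genuine) eigenvalues be given, with counting function $\mathcal{N}^{\mathrm{num}}(t)$, and set $S^{\mathrm{num}}(t)=\mathcal{N}^{\mathrm{num}}(t)-\mathcal{M}(t)$ and $\langle S^{\mathrm{num}}(t)\rangle=\frac1t\int_0^t S^{\mathrm{num}}(\tau)\,d\tau$. Let $t_0>0$ and let functions $E_{\mathrm{lower}},E_{\mathrm{upper}}$ (lower and upper Turing bounds) be given such that $$-1/2<E_{\mathrm{lower}}(t)<\langle S(t)\rangle<E_{\mathrm{upper}}(t)<1/2\quad\text{for all } t\ge t_0.$$ Let $$T:=\min\{\tau\ge t_0 : \langle S^{\mathrm{num}}(\tau)\rangle\le E_{\mathrm{lower}}(\tau)\}$$ and $$t:=T\max\bigl(0,\ \langle S^{\mathrm{num}}(T)\rangle-E_{\mathrm{upper}}(T)+1\bigr).$$ Then the list of eigenvalues is consecutive (contains all eigenvalues, with multiplicity) for $1/4\le\lambda<t^2+1/4$, but there is an eigenvalue missing from the list in $t^2+1/4\le\lambda\le T^2+1/4$.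
   Context: $\mathcal{H}$ is the upper half-plane with metric $ds=|dz|/y$, $\Gamma\subset\mathrm{SL}(2,\mathbb{R})$ is a cofinite non-cocompact Fuchsian group, and the Laplacian is $\Delta=-y^2(\partial_x^2+\partial_y^2)$; its discrete eigenvalues (counted with multiplicity) correspond to Maass cusp forms. $\mathcal{N}(t)=\#\{\lambda : 1/4\le\lambda\le t^2+1/4\}$ counts discrete eigenvalues (with multiplicity) in $[1/4,t^2+1/4]$. $\mathcal{M}(t)$ is a smooth approximation to $\mathcal{N}(t)$ (average Weyl's law) chosen such that the Weyl remainder $S(t)=\mathcal{N}(t)-\mathcal{M}(t)$ has mean tending to zero: $\langle S(t)\rangle:=\frac1t\int_0^t S(\tau)\,d\tau\to0$ as $t\to\infty$. The given list is assumed to consist of true eigenvalues of the Laplacian (with multiplicities not exceeding the true ones), so that $\mathcal{N}^{\mathrm{num}}(t)\le\mathcal{N}(t)$ for all $t$, where $\mathcal{N}^{\mathrm{num}}(t)$ counts listed eigenvalues in $[1/4,t^2+1/4]$. *)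

(* Defs.v *)
From HB Require Import structures.
From mathcomp Require Import all_boot all_order all_algebra.
From mathcomp Require Import all_classical all_reals all_analysis.
From mathcomp Require Import complex.

Set Implicit Arguments.
Unset Strict Implicit.
Unset Printing Implicit Defensive.

Import Order.TTheory GRing.Theory Num.Theory.
Import numFieldNormedType.Exports.

Local Open Scope classical_set_scope.
Local Open Scope complex_scope.
Local Open Scope ring_scope.

(* Points of the plane are coordinate pairs (x, y), standing for x + iy, so
   that the library's product topology, product measure and partial
   derivatives apply. *)
Definition halfplane (R : realType) : set (R * R) := [set p | 0 < p.2].

Definition mobius (R : realType) (g : 'M[R]_2) (p : R * R) : R * R :=
  let z : R[i] := p.1 +i* p.2 in
  let w : R[i] := ((g 0 0)%:C * z + (g 0 1)%:C) /
                  ((g 1 0)%:C * z + (g 1 1)%:C) in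
  (complex.Re w, complex.Im w).

Definition SL2_subgroup (R : realType) (Gamma : set 'M[R]_2) : Prop :=
  [/\ forall g, Gamma g -> \det g = 1,
      Gamma 1%:M,
      forall g h, Gamma g -> Gamma h -> Gamma (g *m h) &
      forall g, Gamma g -> Gamma (invmx g)].

Definition fuchsian (R : realType) (Gamma : set 'M[R]_2) : Prop :=
  SL2_subgroup Gamma /\ isolated Gamma = Gamma.

Definition mobius_orbit (R : realType) (Gamma : set 'M[R]_2) (p : R * R) :
  set (R * R) := [set mobius g p | g in Gamma].

(* A measurable set of representatives for Gamma \ H.  For a Fuchsian group
   such sets exist, and the hyperbolic integral over one of them of a
   nonnegative Gamma-invariant function does not depend on the choice: it is
   the integral over the quotient. *)
Definition fundamental_domain (R : realType) (Gamma : set 'M[R]_2)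
    (F : set (R * R)) : Prop :=
  [/\ measurable F, F `<=` @halfplane R &
      forall p, halfplane p -> exists! q, F q /\ mobius_orbit Gamma p q].

(* Integration against the hyperbolic area dx dy / y^2. *)
Definition hyp_integral (R : realType) (F : set (R * R)) (h : R * R -> R) :
  \bar R :=
  (\int[(@lebesgue_measure R \x @lebesgue_measure R)]_(p in F)
      (h p / p.2 ^+ 2)%:E)%E.

Definition cofinite (R : realType) (Gamma : set 'M[R]_2) : Prop :=
  exists F, fundamental_domain Gamma F /\ (hyp_integral F (fun=> 1%R) < +oo)%E.

(* Two points are identified when their orbits are equal as sets; for a group
   this says that they lie in the same orbit, and it is an equivalence
   relation without any hypothesis on Gamma. *)
Definition same_orbit (R : realType) (Gamma : set 'M[R]_2) :
  rel (set_type (@halfplane R)) :=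
  fun p q => `[< mobius_orbit Gamma (\val p) = mobius_orbit Gamma (\val q) >].

Lemma same_orbit_equiv (R : realType) (Gamma : set 'M[R]_2) :
  equiv_class_of (same_orbit Gamma).
Proof.
split => [p | p q | q p r].
- by apply/asboolP.
- by apply/asboolP/asboolP => ->.
- by move=> /asboolP pq /asboolP qr; apply/asboolP; rewrite pq.
Qed.

Canonical same_orbit_rel (R : realType) (Gamma : set 'M[R]_2) :
  equiv_rel (set_type (@halfplane R)) :=
  EquivRelPack (same_orbit_equiv Gamma).

(* The space Gamma \ H with the quotient topology. *)
Definition surface (R : realType) (Gamma : set 'M[R]_2) : topologicalType :=
  quotient_topology {eq_quot (same_orbit_rel Gamma)}%qT.

Definition cocompact (R : realType) (Gamma : set 'M[R]_2) : Prop :=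
  compact [set: surface Gamma].

Definition partial (R : realType) (b : bool) (u : R * R -> R) : R * R -> R :=
  fun p => 'D_(if b then (0, 1) else (1, 0)) u p.

(* All iterated partial derivatives are differentiable on H, i.e. u is C^oo
   on H; the values of u off H are irrelevant. *)
Definition smooth_on_halfplane (R : realType) (u : R * R -> R) : Prop :=
  forall (s : seq bool) (p : R * R), halfplane p ->
    differentiable (foldr (@partial R) u s) p.

Definition laplacian (R : realType) (u : R * R -> R) (p : R * R) : R :=
  - p.2 ^+ 2 * (partial false (partial false u) p +
                partial true (partial true u) p).

Definition re (R : realType) (f : R * R -> R[i]) : R * R -> R :=
  fun p => complex.Re (f p).

Definition im (R : realType) (f : R * R -> R[i]) : R * R -> R :=
  fun p => complex.Im (f p).

(* The eigenfunctions of the Laplacian on L^2(Gamma \ H), as automorphic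
   complex-valued functions; the Laplacian acts componentwise.  By elliptic
   regularity nothing is lost by asking for smoothness.  For l >= 1/4 these
   are the Maass cusp forms. *)
Definition eigenfunction (R : realType) (Gamma : set 'M[R]_2) (l : R)
    (f : R * R -> R[i]) : Prop :=
  [/\ smooth_on_halfplane (re f) /\ smooth_on_halfplane (im f),
      forall g p, Gamma g -> halfplane p -> f (mobius g p) = f p,
      forall F, fundamental_domain Gamma F ->
        (hyp_integral F (fun p => re f p ^+ 2 + im f p ^+ 2)%R < +oo)%E &
      forall p, halfplane p ->
        (laplacian (re f) p +i* laplacian (im f) p) = l%:C * f p].

Definition laplace_eigenvalue (R : realType) (Gamma : set 'M[R]_2) (l : R) :
  Prop :=
  exists f, eigenfunction Gamma l f /\ exists2 p, halfplane p & f p != 0.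

Definition independent_on_halfplane (R : realType) (n : nat)
    (f : 'I_n -> R * R -> R[i]) : Prop :=
  forall c : 'I_n -> R[i],
    (forall p, halfplane p -> \sum_(i < n) c i * f i p = 0) ->
    forall i, c i = 0.

(* The complex dimension of the eigenspace for l, a priori possibly +oo; it is
   0 when l is not an eigenvalue. *)
Definition eigenspace_dim (R : realType) (Gamma : set 'M[R]_2) (l : R) :
  \bar R :=
  ereal_sup [set (n%:R)%:E | n in
    [set n : nat | exists f : 'I_n -> R * R -> R[i],
       (forall i, eigenfunction Gamma l (f i)) /\
       independent_on_halfplane f]].

(* Eigenvalues in [1/4, t^2 + 1/4], counted with multiplicity.  The value is an
   extended real so that no finiteness result is presupposed. *)
Definition eigenvalue_count (R : realType) (Gamma : set 'M[R]_2) (t : R) :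
  \bar R :=
  \esum_(l in [set l | 4^-1 <= l <= t ^+ 2 + 4^-1]) eigenspace_dim Gamma l.

Definition listed_count (R : realType) (L : seq R) (t : R) : R :=
  (count (fun l => 4^-1 <= l <= t ^+ 2 + 4^-1) L)%:R.

Definition genuine_list (R : realType) (Gamma : set 'M[R]_2) (L : seq R) :
  Prop :=
  forall l, l \in L ->
    laplace_eigenvalue Gamma l /\
    (((count_mem l L)%:R : R)%:E <= eigenspace_dim Gamma l)%E.

Definition weyl_remainder (R : realType) (Gamma : set 'M[R]_2) (M : R -> R)
    (t : R) : \bar R :=
  (eigenvalue_count Gamma t - (M t)%:E)%E.

Definition weyl_remainder_num (R : realType) (L : seq R) (M : R -> R)
    (t : R) : \bar R :=
  (listed_count L t - M t)%:E.

(* <f(t)>.  The integral of a function whose positive part has infinite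
   integral is never finite, so a finite bound on the mean of the Weyl remainder
   makes that remainder integrable on [0, t] and the counting function finite
   below t. *)
Definition time_mean (R : realType) (f : R -> \bar R) (t : R) : \bar R :=
  ((t^-1)%:E * \int[@lebesgue_measure R]_(tau in `[0%R, t]) f tau)%E.

(* Smooth on the open half-line only: the terms of an average Weyl law include
   t ln t, which is not differentiable at 0. *)
Definition smooth_pos (R : realType) (M : R -> R) : Prop :=
  forall (n : nat) (t : R), 0 < t -> derivable (derive1n n M) t 1.

(* Smooth M with <S(t)> -> 0 as t -> +oo. *)
Definition average_weyl_law (R : realType) (Gamma : set 'M[R]_2)
    (M : R -> R) : Prop :=
  smooth_pos M /\
  time_mean (weyl_remainder Gamma M) t @[t --> +oo] --> (0%:E : \bar R).

Definition is_min (R : realType) (A : set R) (m : R) : Prop :=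
  A m /\ lbound A m.

(* Main.v *)
(* The counting functions N and N_num differ by a nonnegative nondecreasing
   step function that jumps by at least 1 at every missing eigenvalue.  A
   missing eigenvalue s^2 + 1/4 with s < T therefore gives
   <S(T)> >= <S_num(T)> + 1 - s/T, so <S(T)> < E_upper(T) forces s > t (when
   t > 0).  Conversely, if nothing is missing up to T^2 + 1/4 then S = S_num on
   [0, T], against <S_num(T)> <= E_lower(T) < <S(T)>.  The Turing bound at T + 1
   makes N finite at T, and hence M and S_num integrable on [0, T]. *)
Require Import Defs.
From HB Require Import structures.
From mathcomp Require Import all_boot all_order all_algebra.
From mathcomp Require Import all_classical all_reals all_analysis.
From mathcomp Require Import measurable_realfun complex lra.
Import Order.TTheory GRing.Theory Num.Theory.
Import numFieldNormedType.Exports.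
Local Open Scope classical_set_scope.
Local Open Scope ring_scope.

(** * Counting with multiplicity *)

(** Gives [listed_count] the same shape as [eigenvalue_count], a sum of multiplicities over real
    numbers, so that the two can be compared term by term. *)
Lemma esum_count_mem (R : realType) (P : pred R) (L : seq R) :
  (\esum_(l in [set l | P l]) (count_mem l L)%:R%:E = (count P L)%:R%:E :> \bar R)%E.
Proof.
elim: L => [|a L IH] /=; first by rewrite esum1.
transitivity (\esum_(l in [set l | P l])
    (((a == l)%:R : R)%:E + ((count_mem l L)%:R : R)%:E))%E.
  by apply: eq_esum => l _; rewrite natrD EFinD.
rewrite esumD; [|by move=> l _; rewrite lee_fin ler0n..].
rewrite IH natrD EFinD; congr (_ + _)%E.
rewrite (esumID [set a]); last by move=> l _; rewrite lee_fin ler0n.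
rewrite [X in (_ + X)%E]esum1 ?adde0; last first.
  by move=> l [_ /= /eqP]; rewrite eq_sym => /negbTE ->.
case: (boolP (P a)) => Pa.
  rewrite (_ : _ `&` _ = [set a]) ?esum_set1 ?eqxx ?lee_fin//.
  by apply/seteqP; split=> [l []//|l /= ->].
by rewrite esum1 // => l [/= Pl la]; rewrite la (negbTE Pa) in Pl.
Qed.

Lemma eigenspace_dim_ge0 (R : realType) (Gamma : set 'M[R]_2) (l : R) :
  (0 <= eigenspace_dim Gamma l)%E.
Proof.
apply: ereal_sup_ubound; exists 0%N => //=.
by exists (fun i => (fun=> 0)); split=> [[]//|c _ []].
Qed.

(** The dimension is a supremum of natural numbers, so exceeding [n] requires an independent family
    of at least [n.+1] eigenfunctions. A missing eigenvalue thus leaves room for one more list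
    entry. *)
Lemma eigenspace_dim_gtn (R : realType) (Gamma : set 'M[R]_2) (l : R) (n : nat) :
  ((n%:R : R)%:E < eigenspace_dim Gamma l)%E ->
  ((n.+1%:R : R)%:E <= eigenspace_dim Gamma l)%E.
Proof.
move=> /ereal_sup_gt[_ [m Hm <-]]; rewrite lte_fin ltr_nat => nm.
apply: (@le_trans _ _ (m%:R%:E)); first by rewrite lee_fin ler_nat.
by apply: ereal_sup_ubound; exists m.
Qed.

Lemma eigenvalue_count_ge0 (R : realType) (Gamma : set 'M[R]_2) (t : R) :
  (0 <= eigenvalue_count Gamma t)%E.
Proof. by apply: esum_ge0 => l _; exact: eigenspace_dim_ge0. Qed.

Lemma le_eigenvalue_count (R : realType) (Gamma : set 'M[R]_2) (s t : R) :
  0 <= s -> s <= t -> (eigenvalue_count Gamma s <= eigenvalue_count Gamma t)%E.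
Proof.
move=> s0 st; rewrite /eigenvalue_count [leLHS]esum_mkcond [leRHS]esum_mkcond.
apply: le_esum => l _; case: ifPn => [|_]; last first.
  by case: ifP => // _; exact: eigenspace_dim_ge0.
rewrite inE /= => /andP[l4 ls]; rewrite ifT // inE /= l4 /=.
by apply: le_trans ls _; rewrite lerD2r lerXn2r // nnegrE (le_trans s0).
Qed.

(** * Measurability and integrability of the Weyl remainder *)

(** By monotonicity the preimage of each generating ray is an interval. *)
Lemma measurable_nondecreasing_in (R : realType) (D : set R) (f : R -> \bar R) :
  is_interval D ->
  (forall s t, D s -> D t -> s <= t -> (f s <= f t)%E) -> measurable_fun D f.
Proof.
move=> itvD f_nd mD; apply: (measurability _ (ErealGenCInfty.measurableE R)) => //.
move=> _ [_ [r ->] <-].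
apply: is_interval_measurable => s t /= [Ds fs] [Dt _] u sut.
have Du : D u by exact: itvD sut.
split => //; move: fs; rewrite /= !in_itv /= !andbT => /le_trans; apply.
by apply: f_nd => //; case/andP: sut.
Qed.

Lemma integrable_nondecreasing (R : realType) (a b : R) (f : R -> \bar R) :
  a <= b -> (0 <= f a)%E -> (f b < +oo)%E ->
  (forall s t, a <= s -> s <= t -> t <= b -> (f s <= f t)%E) ->
  (@lebesgue_measure R).-integrable `[a, b] f.
Proof.
move=> ab fa fb f_nd.
have f_ge0 x : a <= x -> x <= b -> (0 <= f x)%E.
  by move=> ax xb; apply: le_trans fa _; exact: f_nd.
apply: (@le_integrable _ _ _ _ _ _ _ (EFin \o cst (fine (f b)))) => //.
- apply: measurable_nondecreasing_in; first exact: interval_is_interval.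
  move=> s t /=; rewrite !in_itv /= => /andP[as_ _] /andP[_ tb] st.
  exact: f_nd.
- move=> x; rewrite /= in_itv /= => /andP[ax xb].
  rewrite gee0_abs ?f_ge0 // ger0_norm ?fine_ge0 ?f_ge0 //.
  by rewrite fineK ?ge0_fin_numE ?f_ge0 // f_nd.
- apply: measurable_bounded_integrable => //; last exact: bounded_cst.
  by rewrite /= lebesgue_measure_itv /= lte_fin; case: ifP; rewrite -?EFinB ltry.
Qed.

(** Smoothness says nothing at 0, so that point is split off: every function is measurable on a
    singleton. *)
Lemma measurable_smooth_pos (R : realType) (M : R -> R) (b : R) :
  smooth_pos M -> measurable_fun `[0, b] M.
Proof.
move=> sM; apply: (@measurable_funS _ _ _ _ (([set 0] : set R) `|` [set` `]0, +oo[])).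
- exact: measurableU.
- move=> x /=; rewrite !in_itv /= andbT => /andP[+ _].
  by rewrite le_eqVlt => /orP[/eqP <-|]; [left|right].
- apply/measurable_funU => //; split; first exact: measurable_fun_set1.
  apply: open_continuous_measurable_fun; first exact: interval_open.
  move=> x; rewrite inE /= in_itv /= andbT => x0.
  by apply: differentiable_continuous; apply/derivable1_diffP; exact: (sM 0%N x x0).
Qed.

(** The integral is the difference of those of the positive and negative parts, and [+oo - +oo] is
    [-oo] by convention; a finite value leaves both parts finite. *)
Lemma integrable_fin_num_integral d (T : measurableType d) (R : realType)
    (mu : {measure set T -> \bar R}) (D : set T) (f : T -> \bar R) :
  measurable D -> measurable_fun D f ->
  (\int[mu]_(x in D) f x \is a fin_num)%E -> mu.-integrable D f.
Proof.
move=> mD mf fin; apply/integrableP; split => //.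
apply/(abse_integralP mu mD mf).
by rewrite ltey_eq abse_fin_num fin.
Qed.

Lemma time_mean_fin_num (R : realType) (f : R -> \bar R) (t : R) :
  0 < t -> time_mean f t \is a fin_num ->
  (\int[@lebesgue_measure R]_(x in `[0%R, t]) f x \is a fin_num)%E.
Proof.
rewrite /time_mean => t0; case: (integral _ _ _) => [//||].
- by rewrite gt0_muley ?lte_fin ?invr_gt0.
- by rewrite gt0_muleNy ?lte_fin ?invr_gt0.
Qed.

Lemma integrable_weyl_remainder (R : realType) (Gamma : set 'M[R]_2)
    (M : R -> R) (b : R) :
  smooth_pos M -> 0 < b ->
  time_mean (weyl_remainder Gamma M) b \is a fin_num ->
  (@lebesgue_measure R).-integrable `[0, b] (weyl_remainder Gamma M).
Proof.
move=> sM b0 fin; apply: integrable_fin_num_integral => //.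
- apply: emeasurable_funB; last first.
    by apply/measurable_EFinP; exact: measurable_smooth_pos.
  apply: measurable_nondecreasing_in; first exact: interval_is_interval.
  move=> s t /=; rewrite !in_itv /= => /andP[s0 _] _.
  exact: le_eigenvalue_count.
- exact: time_mean_fin_num.
Qed.

(** If the count were infinite at [a], it would be so on all of [[a, b]], a set of positive measure,
    whereas an integrable function is finite almost everywhere. *)
Lemma eigenvalue_count_lty (R : realType) (Gamma : set 'M[R]_2) (M : R -> R)
    (a b : R) :
  (@lebesgue_measure R).-integrable `[0, b] (weyl_remainder Gamma M) ->
  0 <= a -> a < b -> (eigenvalue_count Gamma a < +oo)%E.
Proof.
move=> iS a0 ab; rewrite ltey; apply/eqP => Na.
have /integrable_ae : (@lebesgue_measure R).-integrable `[0, b]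
    (weyl_remainder Gamma M) by [].
case=> [|A [mA A0 sub]]; first exact: measurable_itv.
have : (@lebesgue_measure R `[a, b] <= @lebesgue_measure R A)%E.
  apply: le_measure; rewrite ?inE //.
  apply: subset_trans sub => x /=; rewrite in_itv /= => /andP[ax xb].
  have x0 : 0 <= x by exact: le_trans ax.
  rewrite in_itv /= x0 xb => /(_ isT).
  have := le_eigenvalue_count _ Gamma _ _ a0 ax; rewrite Na leye_eq => /eqP Nx.
  by rewrite /weyl_remainder Nx.
by rewrite A0 lebesgue_measure_itv /= lte_fin ab -EFinB lee_fin subr_le0 leNgt ab.
Qed.

(** [M] is recovered as the count minus the remainder; the count is integrable, being nondecreasing
    with a finite value at [b]. *)
Lemma integrable_weyl_term (R : realType) (Gamma : set 'M[R]_2) (M : R -> R)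
    (b : R) :
  smooth_pos M -> 0 <= b ->
  (@lebesgue_measure R).-integrable `[0, b] (weyl_remainder Gamma M) ->
  (eigenvalue_count Gamma b < +oo)%E ->
  (@lebesgue_measure R).-integrable `[0, b] (EFin \o M).
Proof.
move=> sM b0 iS Nb.
have finN x : `[0, b]%classic x -> eigenvalue_count Gamma x \is a fin_num.
  rewrite /= in_itv /= => /andP[x0 xb].
  rewrite ge0_fin_numE ?eigenvalue_count_ge0 //.
  by apply: le_lt_trans Nb; exact: le_eigenvalue_count.
have iN : (@lebesgue_measure R).-integrable `[0, b] (eigenvalue_count Gamma).
  apply: integrable_nondecreasing => //; first exact: eigenvalue_count_ge0.
  by move=> x y x0 xy _; exact: le_eigenvalue_count.
have : (@lebesgue_measure R).-integrable `[0, b]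
    (eigenvalue_count Gamma \- weyl_remainder Gamma M)%E.
  by apply: integrableB => //; exact: measurable_itv.
apply: eq_integrable => [|x]; first exact: measurable_itv.
rewrite inE => xb.
(* Cancelling the count against itself is legitimate only where it is finite. *)
by rewrite /= /weyl_remainder oppeB ?fin_num_adde_defl // addeA subee ?finN // add0e.
Qed.

(** * Comparison of the list with the true spectrum *)

Lemma listed_count_le (R : realType) (Gamma : set 'M[R]_2) (L : seq R) (t : R) :
  (forall l, (((count_mem l L)%:R : R)%:E <= eigenspace_dim Gamma l)%E) ->
  ((listed_count L t)%:E <= eigenvalue_count Gamma t)%E.
Proof.
by move=> dimL; rewrite /listed_count -esum_count_mem; apply: le_esum => l _.
Qed.

Lemma genuine_list_count (R : realType) (Gamma : set 'M[R]_2) (L : seq R) (l : R) :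
  genuine_list Gamma L ->
  (((count_mem l L)%:R : R)%:E <= eigenspace_dim Gamma l)%E.
Proof.
move=> gL; have [/gL[]//|/count_memPn ->] := boolP (l \in L).
exact: eigenspace_dim_ge0.
Qed.

Lemma integrable_weyl_remainder_num (R : realType) (L : seq R) (M : R -> R)
    (T : R) :
  0 <= T -> (@lebesgue_measure R).-integrable `[0, T] (EFin \o M) ->
  (@lebesgue_measure R).-integrable `[0, T] (weyl_remainder_num L M).
Proof.
move=> T0 iM.
have iLn : (@lebesgue_measure R).-integrable `[0, T] (EFin \o listed_count L).
  apply: integrable_nondecreasing => [//||//=|x y x0 xy _].
  - by rewrite lee_fin ler0n.
  - by rewrite ltry.
  - rewrite lee_fin ler_nat; apply: sub_count => l /= /andP[-> lx] /=.
    by apply: le_trans lx _; rewrite lerD2r lerXn2r // nnegrE (le_trans x0).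
have : (@lebesgue_measure R).-integrable `[0, T]
  ((EFin \o listed_count L) \- (EFin \o M))%E.
  by apply: integrableB => //; exact: measurable_itv.
by apply: eq_integrable => [|x _]; first exact: measurable_itv.
Qed.

(** The list enlarged by the missing eigenvalue still respects all true multiplicities. On [[s, T]]
    its count exceeds that of [L] by 1, which adds [T - s] to the integral and [1 - s / T] to the
    mean. *)
Lemma time_mean_missing (R : realType) (Gamma : set 'M[R]_2) (M : R -> R)
    (L : seq R) (s T : R) :
  (@lebesgue_measure R).-integrable `[0, T] (weyl_remainder Gamma M) ->
  (@lebesgue_measure R).-integrable `[0, T] (EFin \o M) ->
  (forall l, (((count_mem l L)%:R : R)%:E <= eigenspace_dim Gamma l)%E) ->
  0 <= s -> s < T ->
  (((count_mem (s ^+ 2 + 4^-1) L)%:R : R)%:E <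
    eigenspace_dim Gamma (s ^+ 2 + 4^-1))%E ->
  ((fine (time_mean (weyl_remainder_num L M) T) + (1 - s / T))%:E <=
    time_mean (weyl_remainder Gamma M) T)%E.
Proof.
move=> iS iM dimL s0 sT missing.
have T0 : 0 < T by exact: le_lt_trans sT.
set l0 := s ^+ 2 + 4^-1 in missing *.
have dimL0 l : (((count_mem l (l0 :: L))%:R : R)%:E <= eigenspace_dim Gamma l)%E.
  rewrite /=; case: eqVneq => [<-|_]; last by rewrite add0n.
  by rewrite add1n; exact: eigenspace_dim_gtn.
have iSn := integrable_weyl_remainder_num _ L _ _ (ltW T0) iM.
have i1 : (@lebesgue_measure R).-integrable `[0, T] (fun x => (\1_`[s, T] x)%:E).
  apply: integrable_nondecreasing => [||//=|x y x0 xy yT]; first exact: ltW.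
  - by rewrite lee_fin indicE ler0n.
  - by rewrite ltry.
  - rewrite lee_fin !indicE ler_nat.
    case: (boolP (x \in _)) => // /[!inE] /=; rewrite in_itv /= => /andP[sx _].
    by rewrite mem_set //= in_itv /= yT (le_trans sx).
(* Pointwise, the left integrand is at most the remainder of the enlarged list [l0 :: L], hence at
   most the true one. *)
have : (\int[@lebesgue_measure R]_(x in `[0%R, T]) (weyl_remainder_num L M x + (\1_`[s, T] x)%:E) <=
        \int[@lebesgue_measure R]_(x in `[0%R, T]) weyl_remainder Gamma M x)%E.
  apply: le_integral => //; first exact: integrableD.
  move=> x; rewrite inE /= in_itv /= => /andP[x0 xT].
  rewrite /weyl_remainder_num -EFinD addrAC EFinB leeB //.
  apply: le_trans (listed_count_le _ _ _ x dimL0); rewrite lee_fin /listed_count /=.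
  rewrite natrD addrC lerD2r indicE ler_nat.
  case: (boolP (x \in _)) => // /[!inE] /=; rewrite in_itv /= => /andP[sx _].
  by rewrite /l0 lerD2r lerXn2r ?nnegrE // lerDr sqr_ge0.
rewrite integralD // integral_indic // (_ : _ `&` _ = `[s, T]%classic); last first.
  apply/setIidPl => x /=; rewrite !in_itv /= => /andP[sx ->].
  by rewrite (le_trans s0).
rewrite [X in (_ + X)%E]/= lebesgue_measure_itv /= lte_fin sT -EFinB => le_int.
have /integrable_fin_num finSn := iSn.
have {}finSn := finSn (measurable_itv _).
rewrite /time_mean -(fineK finSn) -EFinM /=.
move: le_int; rewrite -(fineK finSn) -EFinD.
rewrite -(@lee_pmul2l _ (T^-1%:E)) ?lte_fin ?invr_gt0 //.
apply: le_trans; rewrite -EFinM lee_fin mulrDr lerD2l mulrBr mulVf ?gt_eqF //.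
by rewrite mulrC.
Qed.

Theorem theorem5 (R : realType) (Gamma : set 'M[R]_2) (M : R -> R)
    (L : seq R) (t0 : R) (Elower Eupper : R -> R) (T : R)
    (hGamma : fuchsian Gamma)
    (hcofinite : cofinite Gamma)
    (hnoncompact : ~ cocompact Gamma)
    (hinfinite : infinite_set
       [set l : R | 4^-1 <= l /\ laplace_eigenvalue Gamma l])
    (hM : average_weyl_law Gamma M)
    (hL : genuine_list Gamma L)
    (ht0 : 0 < t0)
    (hturing : forall t : R, t0 <= t ->
      [/\ - 2^-1 < Elower t,
          ((Elower t)%:E < time_mean (weyl_remainder Gamma M) t)%E,
          (time_mean (weyl_remainder Gamma M) t < (Eupper t)%:E)%E &
          Eupper t < 2^-1])
    (hT : is_min [set tau : R | t0 <= tau /\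
            (time_mean (weyl_remainder_num L M) tau <= (Elower tau)%:E)%E] T) :
  let t := T * Num.max 0
             (fine (time_mean (weyl_remainder_num L M) T) - Eupper T + 1) in
  (forall l : R, 4^-1 <= l < t ^+ 2 + 4^-1 ->
     ((count_mem l L)%:R : R)%:E = eigenspace_dim Gamma l) /\
  (exists l : R, t ^+ 2 + 4^-1 <= l <= T ^+ 2 + 4^-1 /\
     (((count_mem l L)%:R : R)%:E < eigenspace_dim Gamma l)%E).
Proof.
have T0 : 0 < T by case: hT => -[/(lt_le_trans ht0)].
have [sM _] := hM.
have iSmean b : t0 <= b ->
    (@lebesgue_measure R).-integrable `[0, b] (weyl_remainder Gamma M).
  move=> tb; have [_ lo hi _] := hturing _ tb.
  apply: integrable_weyl_remainder => //; first exact: lt_le_trans tb.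
  by rewrite fin_numE; apply/andP; split; apply/eqP => E; move: lo hi; rewrite E.
have [[t0T numT] _] := hT.
have [_ lo hi _] := hturing _ t0T.
have iS := iSmean _ t0T.
have NT : (eigenvalue_count Gamma T < +oo)%E.
  (* Integrability on [[0, T]] alone bounds the count only strictly below [T], so a larger endpoint
     is taken. *)
  apply: (eigenvalue_count_lty _ _ M _ (T + 1)); [|exact: ltW|by rewrite ltrDl].
  by apply: iSmean; rewrite (le_trans t0T) // lerDl.
have iM := integrable_weyl_term _ _ _ _ sM (ltW T0) iS NT.
have dimL l := genuine_list_count _ _ _ l hL.
move=> t.
have t_ge0 : 0 <= t by rewrite mulr_ge0 ?(ltW T0) // le_max lexx.
(* Since the numerical mean at [T] is at most [Elower T < Eupper T], the factor of [T] in [t] is at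
   most 1. A missing [s < t] is then also below [T]. *)
have tT : t <= T.
  rewrite /t ler_piMr ?(ltW T0) // ge_max ler01 /=.
  (* [fine] sends infinite values to 0, so finiteness must come before the bound [numT] can be read
     in the reals. *)
  have Sn_fin : time_mean (weyl_remainder_num L M) T \is a fin_num.
    have /integrable_fin_num := integrable_weyl_remainder_num _ L _ _ (ltW T0) iM.
    by move=> /(_ (measurable_itv _)) ?; rewrite fin_numM.
  move: numT (lt_trans lo hi); rewrite -(fineK Sn_fin) lee_fin lte_fin /=.
  by lra.
have consecutive (l : R) : 4^-1 <= l < t ^+ 2 + 4^-1 ->
    ((count_mem l L)%:R : R)%:E = eigenspace_dim Gamma l.
  move=> /andP[l4 lt]; apply/eqP; rewrite eq_le dimL /= leNgt; apply/negP => missing.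
  pose s := Num.sqrt (l - 4^-1).
  have s2 : s ^+ 2 + 4^-1 = l by rewrite sqr_sqrtr ?subr_ge0 // subrK.
  have st : s < t.
    by rewrite -(@ltr_pXn2r _ 2) ?nnegrE ?sqrtr_ge0 // -(ltrD2r 4^-1) s2.
  have := time_mean_missing _ _ _ _ _ _ iS iM dimL (sqrtr_ge0 _) (lt_le_trans st tT).
  rewrite -/s s2 => /(_ missing) le_mean.
  have := le_lt_trans le_mean hi.
  rewrite lte_fin => lt_hi.
  (* As [0 <= s < t], the maximum is not attained by 0 alone. Hence [s / T] is less than the
     numerical mean minus [Eupper T] plus 1, which contradicts [lt_hi]. *)
  have : 0 < t by apply: le_lt_trans st; exact: sqrtr_ge0.
  rewrite /t pmulr_rgt0 // lt_max ltxx /= => mpos.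
  move: st; rewrite /t max_r ?(ltW mpos) // mulrC -ltr_pdivrMr //.
  by lra.
split => //.
apply: contrapT => none.
have full (l : R) : 4^-1 <= l <= T ^+ 2 + 4^-1 ->
    ((count_mem l L)%:R : R)%:E = eigenspace_dim Gamma l.
  move=> /andP[l4 lT]; have [lt|tl] := ltP l (t ^+ 2 + 4^-1).
    by apply: consecutive; rewrite l4.
  apply/eqP; rewrite eq_le dimL /= leNgt; apply/negP => missing.
  by apply: none; exists l; rewrite tl lT.
suff E : time_mean (weyl_remainder Gamma M) T = time_mean (weyl_remainder_num L M) T.
  by move: (lt_le_trans lo (eq_ind_r (fun x => x <= _)%E numT E)); rewrite ltxx.
(* Equal multiplicities up to [T ^+ 2 + 4^-1] make the two counts, and so the two remainders, agree
   at every point of [[0, T]]. *)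
rewrite /time_mean; congr (_ * _)%E; apply: eq_integral => x.
rewrite inE /= in_itv /= => /andP[x0 xT].
rewrite /weyl_remainder /weyl_remainder_num EFinB; congr (_ - _)%E.
rewrite /listed_count -esum_count_mem; apply: eq_esum => l /= /andP[l4 lx].
rewrite full // l4 /=; apply: le_trans lx _.
by rewrite lerD2r lerXn2r // nnegrE ?(ltW T0).
Qed.
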